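(* Let $z$ be an integer with $z>2$. For every integer $t\ge 0$, the average degree $\langle k_t\rangle$ of the graph $G_t^z$ satisfies $$\langle k_t\rangle=\frac{4}{3}(1-z)\left(\frac{z-1}{z}\right)^{t}+\frac{4z+2}{3},$$ and consequently $\langle k_t\rangle\to\frac{4z+2}{3}$ as $t\to\infty$.
   Context: Fix an integer $z>2$. The finite simple graphs $G_t^z$ ($t=0,1,2,\dots$), each with a distinguished vertex called its root (its largest, original hub node) and a distinguished set of vertices called its last-layer bottom nodes, are defined recursively. $G_0^z$ is a triangle; one of its vertices is the root (hub node) and the other two are its (last-layer) bottom nodes. For $t\ge1$, $G_t^z$ is formed from the disjoint union of $z$ copies of $G_{t-1}^z$, one called the original and the other $z-1$ called replicas, by adding an edge from the root of the original copy to every last-layer bottom node of each of the $z-1$ replicas. The root of $G_t^z$ is the root of the original copy, and the last-layer bottom nodes of $G_t^z$ are the last-layer bottom nodes of all $z-1$ replicas. The average degree $\langle k_t\rangle$ is the arithmetic mean of the degrees of all vertices of $G_t^z$. *)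

(* Defs.v *)
From HB Require Import structures.
From mathcomp Require Import all_boot all_order all_algebra.
From mathcomp Require Import all_classical all_reals all_analysis.

Set Implicit Arguments.
Unset Strict Implicit.
Unset Printing Implicit Defensive.

Import Order.TTheory GRing.Theory Num.Theory.
Import numFieldNormedType.Exports.

Record hubGraph := HubGraph {
  vertex : finType;
  adj : rel vertex;
  adj_sym : symmetric adj;
  adj_irr : irreflexive adj;
  hub : vertex;
  bottom : {set vertex}
}.

Arguments adj {h} u v : rename.

Section Triangle.

Definition triangle_adj : rel 'I_3 := fun u v => u != v.

Lemma triangle_adj_sym : symmetric triangle_adj.
Proof. by move=> u v; rewrite /triangle_adj eq_sym. Qed.

Lemma triangle_adj_irr : irreflexive triangle_adj.
Proof. by move=> u; rewrite /triangle_adj eqxx. Qed.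

Definition triangle : hubGraph :=
  HubGraph triangle_adj_sym triangle_adj_irr ord0 [set v | v != ord0].

End Triangle.

Section Step.

Variables (z : nat) (G : hubGraph).

(* [inl v] is the vertex [v] of the original copy and [inr (i, v)] is the
   vertex [v] of the [i]-th replica, so there are [z] copies when [0 < z]. *)
Definition step_vertex : finType := (vertex G + 'I_z.-1 * vertex G)%type.

Definition step_adj : rel step_vertex := fun x y =>
  match x, y with
  | inl u, inl v => adj u v
  | inr (i, u), inr (j, v) => (i == j) && adj u v
  | inl u, inr (_, v) => (u == hub G) && (v \in bottom G)
  | inr (_, u), inl v => (v == hub G) && (u \in bottom G)
  end.

Lemma step_adj_sym : symmetric step_adj.
Proof.
move=> [u|[i u]] [v|[j v]] //=; first exact: adj_sym.
by rewrite eq_sym adj_sym.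
Qed.

Lemma step_adj_irr : irreflexive step_adj.
Proof. by move=> [u|[i u]] /=; rewrite adj_irr ?andbF. Qed.

Definition step_bottom : {set step_vertex} :=
  [set x : step_vertex | if x is inr (_, v) then v \in bottom G else false].

Definition step : hubGraph :=
  HubGraph step_adj_sym step_adj_irr (inl (hub G)) step_bottom.

End Step.

Fixpoint hier_graph (z t : nat) : hubGraph :=
  if t is t'.+1 then step z (hier_graph z t') else triangle.

Definition degree (G : hubGraph) (v : vertex G) : nat :=
  #|[set w : vertex G | adj v w]|.

Definition average_degree (R : realType) (G : hubGraph) : R :=
  ((\sum_(v : vertex G) (degree v)%:R) / #|vertex G|%:R)%R.

(* Main.v *)
Require Import Defs.
From HB Require Import structures.
From mathcomp Require Import all_boot all_order all_algebra.
From mathcomp Require Import all_classical all_reals all_analysis.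
From mathcomp Require Import ring.

Set Implicit Arguments.
Unset Strict Implicit.
Unset Printing Implicit Defensive.

Import Order.TTheory GRing.Theory Num.Theory.
Import numFieldNormedType.Exports.
Local Open Scope classical_set_scope.
Local Open Scope ring_scope.

(* Each step multiplies the number of vertices by z and the number of last-layer
   bottom nodes by z - 1, and every new edge ends at a new bottom node.  Hence
   the degree sum S_t satisfies S_(t+1) = z S_t + 4 (z - 1)^(t+1), and dividing
   by 3 z^(t+1) makes <k_t> a geometric sum of ratio (z - 1) / z. *)

Local Notation degree_sum G := (\sum_(v : vertex G) degree v)%N.

Lemma degreeE (G : hubGraph) (v : vertex G) :
  degree v = (\sum_(w : vertex G) adj v w)%N.
Proof.
rewrite /degree -sum1_card big_mkcond /=; apply: eq_bigr => w _.
by rewrite inE; case: adj.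
Qed.

Lemma sum_mem_card (T : finType) (A : {set T}) :
  (\sum_(x : T) (x \in A))%N = #|A|.
Proof.
by rewrite -sum1_card [RHS]big_mkcond /=; apply: eq_bigr => x _; case: (x \in A).
Qed.

Section StepCounts.

Variables (z : nat) (G : hubGraph).

(** All counts in a step reduce to this split: degrees, which are sums of adjacency bits, as well as
    bottom nodes and degree sums. *)
Lemma sum_step_vertex (F : vertex (step z G) -> nat) :
  (\sum_x F x =
     \sum_(v : vertex G) F (inl v)
     + \sum_(i < z.-1) \sum_(v : vertex G) F (inr (i, v)))%N.
Proof.
rewrite big_sumType /= pair_bigA /=; congr (_ + _)%N.
by apply: eq_bigr => -[].
Qed.

Lemma degree_step_original (u : vertex G) :
  degree (inl u : vertex (step z G)) =
    (degree u + (u == hub G) * (z.-1 * #|Defs.bottom G|))%N.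
Proof.
rewrite !degreeE sum_step_vertex /= sum_nat_const card_ord.
case: (u == hub G) => /=; first by rewrite sum_mem_card mul1n.
by rewrite sum_nat_const !muln0.
Qed.

Lemma degree_step_replica (i : 'I_z.-1) (u : vertex G) :
  degree (inr (i, u) : vertex (step z G)) = (degree u + (u \in Defs.bottom G))%N.
Proof.
rewrite !degreeE sum_step_vertex /= addnC (bigD1 i) //= eqxx /= -addnA.
rewrite [X in (_ + (X + _))%N]big1 ?add0n; last first.
  (* Distinct replicas are not joined to each other. *)
  by move=> j; rewrite eq_sym => /negbTE->; apply: big1.
congr (_ + _)%N; rewrite (bigD1 (hub G)) //= eqxx /= big1 ?addn0 //.
by move=> v /negbTE->.
Qed.

Hypothesis z_gt0 : (0 < z)%N.

Lemma card_vertex_step : #|vertex (step z G)| = (z * #|vertex G|)%N.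
(* As [0 < z], the original and its [z.-1] replicas make exactly [z] copies. *)
Proof. by rewrite card_sum card_prod card_ord -mulSn prednK. Qed.

Lemma card_bottom_step : #|Defs.bottom (step z G)| = (z.-1 * #|Defs.bottom G|)%N.
Proof.
rewrite -sum_mem_card sum_step_vertex big1 ?add0n; last by move=> v _; rewrite inE.
under eq_bigr do under eq_bigr do rewrite inE.
by rewrite sum_nat_const card_ord sum_mem_card.
Qed.

(** The factor 2 is the handshake count: each new edge adds one to the degree of the hub and one to
    that of its bottom end. *)
Lemma degree_sum_step :
  degree_sum (step z G) = (z * degree_sum G + 2 * (z.-1 * #|Defs.bottom G|))%N.
Proof.
rewrite sum_step_vertex.
under eq_bigr do rewrite degree_step_original.
under [X in (_ + X)%N]eq_bigr do under eq_bigr do rewrite degree_step_replica.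
rewrite sum_nat_const card_ord !big_split /= sum_mem_card -big_distrl /=.
have -> : (\sum_(v : vertex G) (v == hub G) = 1)%N.
  by rewrite (bigD1 (hub G)) //= eqxx big1 // => v /negbTE->.
by rewrite mul1n mulnDr addnACA -mulSn prednK // mul2n addnn.
Qed.

End StepCounts.

Section HierGraphCounts.

Variables (z : nat) (z_gt0 : (0 < z)%N).

Lemma card_vertex_hier t : #|vertex (hier_graph z t)| = (3 * z ^ t)%N.
Proof.
elim: t => [|t IH]; first by rewrite /= card_ord.
by rewrite card_vertex_step // IH expnS mulnCA.
Qed.

Lemma card_bottom_hier t : #|Defs.bottom (hier_graph z t)| = (2 * z.-1 ^ t)%N.
Proof.
elim: t => [|t IH].
  by rewrite /= -sum_mem_card !big_ord_recl big_ord0 !inE.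
by rewrite card_bottom_step // IH expnS mulnCA.
Qed.

Lemma degree_sum_triangle : degree_sum triangle = 6%N.
Proof.
under eq_bigr do rewrite degreeE.
by rewrite !(big_ord_recl, big_ord0).
Qed.

(** The 4 is the handshake factor 2 times the two bottom nodes of the triangle. *)
Lemma degree_sum_hierS t :
  degree_sum (hier_graph z t.+1) =
    (z * degree_sum (hier_graph z t) + 4 * z.-1 ^ t.+1)%N.
Proof.
by rewrite degree_sum_step // card_bottom_hier (mulnCA z.-1) -expnS mulnA.
Qed.

Variable R : realType.

Lemma average_degreeE (G : hubGraph) :
  average_degree R G = (degree_sum G)%:R / #|vertex G|%:R.
Proof. by rewrite /average_degree natr_sum. Qed.

Lemma average_degree_hierS t :
  average_degree R (hier_graph z t.+1) =
    average_degree R (hier_graph z t) + 4 / 3 * ((z%:R - 1) / z%:R) ^+ t.+1.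
Proof.
have z_neq0 : z%:R != 0 :> R by rewrite pnatr_eq0 -lt0n.
rewrite !average_degreeE degree_sum_hierS !card_vertex_hier.
(* Splitting off one factor of the denominator lets it cancel the [z] in front of the old degree
   sum. *)
rewrite natrD !natrM !natrX -subn1 natrB // expr_div_n [z%:R ^+ t.+1]exprS.
by field; rewrite z_neq0 expf_neq0.
Qed.

(** With [r = (z - 1) / z], one has [r / (1 - r) = z - 1], so the increments add up to
    [4 / 3 * (z - 1) * (1 - r ^+ t)] on top of the triangle's average 2. *)
Lemma average_degree_hier t :
  average_degree R (hier_graph z t) =
    4 / 3 * (1 - z%:R) * ((z%:R - 1) / z%:R) ^+ t + (4 * z%:R + 2) / 3.
Proof.
have z_neq0 : z%:R != 0 :> R by rewrite pnatr_eq0 -lt0n.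
elim: t => [|t IH].
  by rewrite average_degreeE degree_sum_triangle card_vertex_hier expn0 expr0; field.
by rewrite average_degree_hierS IH exprS; field.
Qed.

End HierGraphCounts.

Theorem theorem3p1 (R : realType) (z : nat) (hz : (2 < z)%N) :
  (forall t : nat,
     average_degree R (hier_graph z t) =
       4 / 3 * (1 - z%:R) * ((z%:R - 1) / z%:R) ^+ t + (4 * z%:R + 2) / 3)
  /\ (average_degree R (hier_graph z t) @[t --> \oo] -->
       ((4 * z%:R + 2) / 3 : R)).
Proof.
have z_gt0 : (0 < z)%N by exact: leq_trans hz.
split; first by move=> t; exact: average_degree_hier.
under eq_fun do rewrite average_degree_hier //.
have zR_gt0 : 0 < z%:R :> R by rewrite ltr0n.
have zR_ge1 : 1 <= z%:R :> R by rewrite ler1n.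
have cvg_ratio : ((z%:R - 1) / z%:R : R) ^+ t @[t --> \oo] --> (0 : R).
  (* The ratio lies in [[0, 1)], so its powers vanish in the limit. *)
  apply: cvg_expr; rewrite ger0_norm; last by rewrite divr_ge0 ?subr_ge0 // ltW.
  by rewrite ltr_pdivrMr // mul1r gtrBl.
(* Keeping the product with 0 in the limit matches the sum and product rules for limits. *)
suff : 4 / 3 * (1 - z%:R) * ((z%:R - 1) / z%:R) ^+ t + (4 * z%:R + 2) / 3
    @[t --> \oo] --> (4 / 3 * (1 - z%:R) * 0 + (4 * z%:R + 2) / 3 : R).
  by rewrite mulr0 add0r.
exact: cvgD (cvgMl_tmp cvg_ratio) (cvg_cst _).
Qed.
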